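(* Let $G$ be a finite graph and $F$ a field of characteristic $0$. For each integer $k \ge 0$ let $V_k$ be the $F$-vector space with basis $\{x_M\}$ indexed by the set $\mathbf{M}_k$ of $k$-matchings of $G$ (so $V_0$ is spanned by $x_{\varnothing}$, and $V_k = 0$ when $G$ has no $k$-matching), and let $\operatorname{Aut}(G)$ act on $V_k$ by $\sigma \cdot x_M = x_{\sigma(M)}$. Then the graded $\operatorname{Aut}(G)$-representation $V_G^{\bullet} = \bigoplus_{k \ge 0} V_k$ is strongly $\operatorname{Aut}(G)$-equivariantly log-concave: for all integers $1 \le \ell \le k$ there exists an injective $\operatorname{Aut}(G)$-equivariant $F$-linear map $V_{\ell-1} \otimes V_{k+1} \hookrightarrow V_{\ell} \otimes V_k$.
   Context: A matching (or $k$-matching) in $G$ is a set of $k$ pairwise non-adjacent edges (no two share a vertex). $\operatorname{Aut}(G)$ is the automorphism group of $G$; an automorphism $\sigma$ maps edges to edges and hence matchings to matchings, $\sigma(M) = \{\sigma(e) : e \in M\}$. The group acts on tensor products diagonally: $\sigma\cdot(x_M \otimes x_{M'}) = x_{\sigma(M)} \otimes x_{\sigma(M')}$. *)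

(* Defs.v *)
From HB Require Import structures.
From mathcomp Require Import all_boot all_algebra all_fingroup.

Set Implicit Arguments.
Unset Strict Implicit.
Unset Printing Implicit Defensive.

Import GRing.Theory.
Local Open Scope ring_scope.

Record sgraph := SGraph {
  vertex :> finType;
  adj : rel vertex;
  adj_sym : symmetric adj;
  adj_irr : irreflexive adj }.

Section Matchings.

Variable G : sgraph.

Definition edges : {set {set G}} :=
  [set [set p.1; p.2] | p in [set p : G * G | adj p.1 p.2]].

Definition is_matching (k : nat) (M : {set {set G}}) : bool :=
  [&& M \subset edges, trivIset M & #|M| == k].

Definition kmatching (k : nat) : finType :=
  {M : {set {set G}} | is_matching k M}.

Definition autG : {set {perm G}} :=
  [set s : {perm G} | [forall x, forall y, adj (s x) (s y) == adj x y]].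

Lemma autGP (s : {perm G}) :
  reflect (forall x y, adj (s x) (s y) = adj x y) (s \in autG).
Proof.
rewrite inE; apply: (iffP forallP) => [h x y|h x].
  by move/forallP: (h x) => /(_ y) /eqP.
by apply/forallP => y; rewrite h.
Qed.

Lemma autG_group_set : group_set autG.
Proof.
apply/group_setP; split; first by apply/autGP => x y; rewrite !perm1.
by move=> s t /autGP hs /autGP ht; apply/autGP => x y; rewrite !permM ht hs.
Qed.

Canonical autG_group := Group autG_group_set.

Definition edge_img (s : {perm G}) (e : {set G}) : {set G} := s @: e.
Definition matching_img (s : {perm G}) (M : {set {set G}}) : {set {set G}} :=
  edge_img s @: M.

Lemma edge_img_inj (s : {perm G}) : injective (edge_img s).
Proof. exact/imset_inj/perm_inj. Qed.

Lemma edge_img_edges (s : {perm G}) (e : {set G}) :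
  s \in autG -> e \in edges -> edge_img s e \in edges.
Proof.
move/autGP => hs /imsetP[[x y]]; rewrite inE /= => xy ->.
apply/imsetP; exists (s x, s y); first by rewrite inE /= hs.
by rewrite /edge_img imsetU !imset_set1.
Qed.

Lemma matching_img_subproof (k : nat) (s : {perm G}) (M : {set {set G}}) :
  s \in autG -> is_matching k M -> is_matching k (matching_img s M).
Proof.
move=> hs /and3P[/subsetP sM /trivIsetP tM /eqP cM]; apply/and3P; split.
- apply/subsetP => _ /imsetP[e eM ->]; exact/edge_img_edges/sM.
- apply/trivIsetP => _ _ /imsetP[a aM ->] /imsetP[b bM ->] nab.
  rewrite imset_disjoint; last exact: perm_inj.
  by apply: tM => //; apply: contraNneq nab => ->.
- by rewrite card_imset ?cM //; apply: edge_img_inj.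
Qed.

Definition kmatching_act (k : nat) (s : [subg autG]) (M : kmatching k) :
    kmatching k :=
  Sub (matching_img (sgval s) (val M))
      (matching_img_subproof (subgP s) (valP M)).

Lemma kmatching_act1 (k : nat) (M : kmatching k) : kmatching_act 1%g M = M.
Proof.
apply: val_inj; rewrite /= /matching_img -[RHS]imset_id; apply: eq_imset => e.
by rewrite /edge_img -[RHS]imset_id; apply: eq_imset => x; rewrite perm1.
Qed.

(* Permutations compose as (s * t) x = t (s x), so this is a right action. *)
Lemma kmatching_actM (k : nat) (s t : [subg autG]) (M : kmatching k) :
  kmatching_act (s * t)%g M = kmatching_act t (kmatching_act s M).
Proof.
apply: val_inj; rewrite /= /matching_img -imset_comp; apply: eq_imset => e /=.
by rewrite /edge_img -imset_comp; apply: eq_imset => x; rewrite permM.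
Qed.

End Matchings.

Section FreeSpaces.

Variable F : fieldType.

(* The space with basis indexed by A, as coordinate functions on A. *)
Definition freeV (A : finType) : Type := {ffun A -> F^o}.
HB.instance Definition _ (A : finType) := Vector.copy (freeV A) {ffun A -> F^o}.

Definition fbasis (A : finType) (a : A) : freeV A := [ffun b => (b == a)%:R].

Definition flift (A : finType) (W : lmodType F) (g : A -> W) (v : freeV A) : W :=
  \sum_(a : A) v a *: g a.

(* The tensor product of freeV A and freeV B is modelled by the space with
   basis A * B; tensor_universal below is its universal property. *)
Definition tensorV (A B : finType) : Type := freeV (A * B)%type.
HB.instance Definition _ (A B : finType) :=
  Vector.copy (tensorV A B) (freeV (A * B)%type).

Definition tens (A B : finType) (v : freeV A) (w : freeV B) : tensorV A B :=
  [ffun p => v p.1 * w p.2].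

Lemma flift_is_linear (A : finType) (W : lmodType F) (g : A -> W) :
  linear (flift g).
Proof.
move=> c u v; rewrite /flift scaler_sumr -big_split /=; apply: eq_bigr => a _.
by rewrite !ffunE scalerDl scalerA.
Qed.

HB.instance Definition _ (A : finType) (W : lmodType F) (g : A -> W) :=
  GRing.isLinear.Build F (freeV A) W _ (flift g) (flift_is_linear g).

Lemma flift_basis (A : finType) (W : lmodType F) (g : A -> W) (a : A) :
  flift g (fbasis a) = g a.
Proof.
rewrite /flift (bigD1 a) //= big1 => [|b /negPf ba]; rewrite !ffunE.
  by rewrite eqxx scale1r addr0.
by rewrite ba scale0r.
Qed.

Lemma fbasis_expand (A : finType) (v : freeV A) : v = \sum_a v a *: fbasis a.
Proof.
apply/ffunP => b; rewrite sum_ffunE (bigD1 b) //= big1 => [|a ab].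
  by rewrite !ffunE eqxx addr0 [_ *: _]mulr1.
by rewrite !ffunE eq_sym (negPf ab) scaler0.
Qed.

Lemma tens_basis (A B : finType) (a : A) (b : B) :
  tens (fbasis a) (fbasis b) = fbasis (a, b).
Proof. by apply/ffunP => -[c d]; rewrite !ffunE /= xpair_eqE -natrM mulnb. Qed.

Lemma tens_linearl (A B : finType) (w : freeV B) :
  linear (fun v : freeV A => tens v w).
Proof.
by move=> c u v; apply/ffunP => p; rewrite !ffunE mulrDl -scalerAl.
Qed.

Lemma tens_linearr (A B : finType) (v : freeV A) :
  linear (fun w : freeV B => tens v w).
Proof.
by move=> c u w; apply/ffunP => p; rewrite !ffunE mulrDr -scalerAr.
Qed.

Lemma tensor_universal (A B : finType) (W : lmodType F)
    (b : freeV A -> freeV B -> W) :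
    (forall w, linear (fun v => b v w)) -> (forall v, linear (b v)) ->
  exists h : {linear tensorV A B -> W},
    (forall v w, h (tens v w) = b v w) /\
    (forall h' : {linear tensorV A B -> W},
      (forall v w, h' (tens v w) = b v w) -> h' =1 h).
Proof.
move=> bl br; pose g (p : A * B) := b (fbasis p.1) (fbasis p.2).
have hE (v : freeV A) (w : freeV B) : flift g (tens v w) = b v w.
  pose bR v := HB.pack_for {linear freeV B -> W} (b v)
    (GRing.isLinear.Build F (freeV B) W _ (b v) (br v)).
  pose bL w := HB.pack_for {linear freeV A -> W} (b^~ w)
    (GRing.isLinear.Build F (freeV A) W _ (b^~ w) (bl w)).
  have -> : b v w = bR v w by [].
  have -> : flift g (tens v w) = \sum_x \sum_y tens v w (x, y) *: g (x, y).
    by rewrite pair_bigA; apply: eq_bigr => -[].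
  rewrite [in RHS](fbasis_expand w) linear_sum exchange_big.
  apply: eq_bigr => y _; rewrite linearZ /=.
  have -> : b v (fbasis y) = bL (fbasis y) v by [].
  rewrite [in RHS](fbasis_expand v) linear_sum scaler_sumr; apply: eq_bigr => x _.
  by rewrite linearZ /= scalerA ffunE /= mulrC.
exists (flift g : {linear freeV (A * B)%type -> W}); split=> // h' h'E t.
rewrite {1}(fbasis_expand t) linear_sum; apply: eq_bigr => -[x y] _.
by rewrite linearZ /= -tens_basis h'E.
Qed.

End FreeSpaces.

Section MatchingRepresentation.

Variables (F : fieldType) (G : sgraph).

Definition Vact (k : nat) (s : [subg autG G]) :
    freeV F (kmatching G k) -> freeV F (kmatching G k) :=
  flift (fun M => fbasis F (kmatching_act s M)).

Definition VVact (i j : nat) (s : [subg autG G]) :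
    tensorV F (kmatching G i) (kmatching G j) ->
    tensorV F (kmatching G i) (kmatching G j) :=
  flift (fun p => tens (fbasis F (kmatching_act s p.1))
                       (fbasis F (kmatching_act s p.2))).

Lemma VVact_tens (i j : nat) (s : [subg autG G])
    (v : freeV F (kmatching G i)) (w : freeV F (kmatching G j)) :
  VVact s (tens v w) = tens (Vact s v) (Vact s w).
Proof.
have bl (w' : freeV F (kmatching G j)) :
    linear (fun v' : freeV F (kmatching G i) => tens (Vact s v') (Vact s w')).
  by move=> c x y; rewrite /Vact linearP tens_linearl.
have br (v' : freeV F (kmatching G i)) :
    linear (fun w' : freeV F (kmatching G j) => tens (Vact s v') (Vact s w')).
  by move=> c x y; rewrite /Vact linearP tens_linearr.
have [h [hE hU]] := tensor_universal bl br.
rewrite -hE {2}(fbasis_expand (tens v w)) linear_sum; apply: eq_bigr => -[M N] _.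
by rewrite linearZ /= -tens_basis hE /Vact !flift_basis.
Qed.

End MatchingRepresentation.

(* Main.v *)
(* For a pair of matchings (M, N), the connected components C of the symmetric
   difference M + N are paths and cycles alternating between M and N, so the
   numbers of M-edges and N-edges in C differ by at most one. Exchanging M and N
   along C preserves M + N and yields again a pair of matchings. Let U send
   (M, N) to the sum of its exchanges along the components with one N-edge in
   excess. Since the components do not change, U and its transpose act as the
   raising and lowering operators of a Boolean lattice, and
     U U^T - U^T U = |N| - |M|
   on the span of the pairs of given sizes. For |N| > |M| the Gram matrix U U^T
   is therefore positive definite over the integers, so its determinant is a
   nonzero integer and U is injective over every field of characteristic 0. It
   commutes with graph automorphisms because no choice was made. *)

Require Import Defs.
From mathcomp Require Import all_boot all_algebra all_fingroup.
From mathcomp Require Import order.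

Import Order.TTheory GRing.Theory Num.Theory.

(** * Exchanges along the blocks of a partition of the symmetric difference *)

Section Flip.

Set Implicit Arguments.
Unset Strict Implicit.

Variables (E : finType) (comp : {set E} -> {set {set E}}).
Hypothesis comp_partition : forall D, partition (comp D) D.

Implicit Types (A B C D : {set E}) (p q : {set E} * {set E}).

Definition symdiff A B : {set E} := [set x | (x \in A) (+) (x \in B)].

Definition flip C p := (symdiff p.1 C, symdiff p.2 C).

Definition gain p : {set {set E}} :=
  [set C in comp (symdiff p.1 p.2) | #|C :&: p.2| == #|C :&: p.1|.+1].

Definition loss p : {set {set E}} :=
  [set C in comp (symdiff p.1 p.2) | #|C :&: p.1| == #|C :&: p.2|.+1].

(** The matrix entry of U from [p] to [q], kept in the naturals so that it can be read over the
    integers and over F alike. *)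
Definition flip_count p q : nat := \sum_(C in gain p) (q == flip C p).

Lemma flipK C : involutive (flip C).
Proof.
by move=> [A B]; congr pair; apply/setP => x; rewrite !inE /= -addbA addbb addbF.
Qed.

Lemma flip_comm C C' p : flip C (flip C' p) = flip C' (flip C p).
Proof. by congr pair; apply/setP => x; rewrite !inE /= addbAC. Qed.

Lemma symdiff_flip C p :
  symdiff (flip C p).1 (flip C p).2 = symdiff p.1 p.2.
Proof.
by apply/setP => x; rewrite !inE /= addbACA addbb addbF.
Qed.

Lemma comp_sub D C : C \in comp D -> C \subset D.
Proof.
move=> cC; rewrite -(cover_partition (comp_partition D)).
by apply/subsetP => x Cx; apply/bigcupP; exists C.
Qed.

(** Inside the symmetric difference the two sets are complementary, so adding C modulo 2 swaps their
    traces on C. *)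
Lemma setI_flip C p : C \in comp (symdiff p.1 p.2) ->
  C :&: (flip C p).1 = C :&: p.2 /\ C :&: (flip C p).2 = C :&: p.1.
Proof.
move/comp_sub/subsetP=> sCD; split; apply/setP => x; rewrite !inE /=;
  case Cx: (x \in C) => //=; move: (sCD x Cx); rewrite inE;
  by case: (x \in p.1) (x \in p.2) => [] [].
Qed.

Lemma setI_flip_neq C C' p : C \in comp (symdiff p.1 p.2) ->
    C' \in comp (symdiff p.1 p.2) -> C' != C ->
  C' :&: (flip C p).1 = C' :&: p.1 /\ C' :&: (flip C p).2 = C' :&: p.2.
Proof.
case/and3P: (comp_partition (symdiff p.1 p.2)) => _ /trivIsetP tI _ cC cC' neq.
have /pred0P dis := tI _ _ cC' cC neq.
by split; apply/setP => x; move: (dis x); rewrite !inE /=;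
  case: (x \in C') => //= ->; rewrite addbF.
Qed.

Lemma mem_gain_flip C p : (C \in gain (flip C p)) = (C \in loss p).
Proof.
rewrite !inE symdiff_flip; case cC: (C \in _) => //=.
by have [-> ->] := setI_flip cC.
Qed.

Lemma mem_loss_flip C p : (C \in loss (flip C p)) = (C \in gain p).
Proof. by rewrite -mem_gain_flip flipK. Qed.

Lemma gain_disjoint_loss C p : C \in gain p -> C \in loss p -> False.
Proof.
rewrite !inE => /andP[_ /eqP->] /andP[_] /eqP H.
by have := leqnn #|C :&: p.1|; rewrite {1}H -addn2 -{2}[#|_|]addn0 leq_add2l.
Qed.

(** The blocks depend only on the symmetric difference, which a flip preserves; the other blocks are
    disjoint from C, so only the status of C changes. *)
Lemma loss_flip C p : C \in gain p -> loss (flip C p) = C |: loss p.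
Proof.
move=> gC; apply/setP => C'; rewrite in_setU1.
have [->|neq] := eqVneq; first by rewrite mem_loss_flip gC.
rewrite !inE symdiff_flip; case cC': (C' \in _) => //=.
move: gC; rewrite inE => /andP[cC _].
by have [-> ->] := setI_flip_neq cC cC' neq.
Qed.

Lemma gain_flip C p : C \in loss p -> gain (flip C p) = C |: gain p.
Proof.
move=> gC; apply/setP => C'; rewrite in_setU1.
have [->|neq] := eqVneq; first by rewrite mem_gain_flip gC.
rewrite !inE symdiff_flip; case cC': (C' \in _) => //=.
move: gC; rewrite inE => /andP[cC _].
by have [-> ->] := setI_flip_neq cC cC' neq.
Qed.

(** Since [flip C] is an involution that turns gains into losses, the transpose of U flips the
    losing blocks. *)
Lemma flip_count_tr p q : flip_count q p = \sum_(C in loss p) (q == flip C p).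
Proof.
rewrite /flip_count big_mkcond [RHS]big_mkcond; apply: eq_bigr => C _.
have -> : (p == flip C q) = (q == flip C p).
  by rewrite -(inj_eq (can_inj (flipK C))) flipK eq_sym.
have [->|] := eqVneq q (flip C p); first by rewrite mem_gain_flip.
by rewrite !if_same.
Qed.

(** An entry of U U^T; the sum over [q] collapses because each gaining C reaches only [flip C p]. *)
Lemma flip_count_gain p p' : \sum_q flip_count p q * flip_count p' q =
  \sum_(C in gain p) flip_count p' (flip C p).
Proof.
under eq_bigr do rewrite {1}/flip_count big_distrl.
rewrite exchange_big; apply: eq_bigr => C _ /=.
rewrite (bigD1 (flip C p)) //= eqxx mul1n big1 ?addn0 // => q /negPf->.
by rewrite mul0n.
Qed.

Lemma flip_count_loss p p' : \sum_q flip_count q p * flip_count q p' =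
  \sum_(C in loss p) flip_count (flip C p) p'.
Proof.
under eq_bigr do rewrite flip_count_tr big_distrl.
rewrite exchange_big; apply: eq_bigr => C _ /=.
rewrite (bigD1 (flip C p)) //= eqxx mul1n big1 ?addn0 // => q /negPf->.
by rewrite mul0n.
Qed.

(* The sl_2 relation: flipping one gaining and one losing component commute,
   and the remaining terms undo a flip. *)
Lemma flip_count_commutator p p' :
  \sum_q flip_count p q * flip_count p' q + #|loss p| * (p' == p) =
  \sum_q flip_count q p * flip_count q p' + #|gain p| * (p' == p).
Proof.
rewrite flip_count_gain flip_count_loss.
have -> : \sum_(C in gain p) flip_count p' (flip C p) = #|gain p| * (p' == p) +
    \sum_(C in gain p) \sum_(C' in loss p) (p' == flip C' (flip C p)).
  rewrite -sum_nat_const -big_split; apply: eq_bigr => C gC /=.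
  rewrite flip_count_tr loss_flip // big_setU1 ?flipK //.
  exact/negP/gain_disjoint_loss.
have -> : \sum_(C in loss p) flip_count (flip C p) p' = #|loss p| * (p' == p) +
    \sum_(C in loss p) \sum_(C' in gain p) (p' == flip C' (flip C p)).
  rewrite -sum_nat_const -big_split; apply: eq_bigr => C lC /=.
  rewrite /flip_count gain_flip // big_setU1 ?flipK //.
  by apply/negP => /gain_disjoint_loss; apply.
rewrite [X in _ + X + _]exchange_big addnAC [RHS]addnC addnA; congr (_ + _).
by apply: eq_bigr => C _; apply: eq_bigr => C' _; rewrite flip_comm.
Qed.

End Flip.

(** * Connected components of a set of edges *)

Section Components.

Set Implicit Arguments.
Unset Strict Implicit.

Variable G : sgraph.

Implicit Types (e f : {set G}) (C D S M N : {set {set G}}) (s : {perm G}).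

Definition meets D : rel {set G} :=
  [rel e f | [&& e \in D, f \in D & ~~ [disjoint e & f]]].

Definition components D : {set {set {set G}}} :=
  equivalence_partition (connect (meets D)) D.

Lemma connect_meets_sym D : connect_sym (meets D).
Proof. by apply: sym_connect_sym => e f; rewrite /meets /= disjoint_sym andbCA. Qed.

Lemma components_partition D : partition (components D) D.
Proof.
apply: equivalence_partitionP => e f g _ _ _; split; first exact: connect0.
by move/(same_connect (connect_meets_sym D)).
Qed.

Lemma components_closed D C e f : C \in components D -> e \in C -> f \in D ->
  ~~ [disjoint e & f] -> f \in C.
Proof.
case/imsetP=> x Dx ->; rewrite !inE => /andP[De xe] Df ef; rewrite Df.
by apply: connect_trans xe (connect1 _); rewrite /meets /= De Df.
Qed.

(** A set closed under meeting is a union of connectivity classes, and C is a single class. *)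
Lemma components_minimal D C S : C \in components D -> S \subset C ->
    S != set0 ->
    (forall e f, e \in S -> f \in D -> ~~ [disjoint e & f] -> f \in S) ->
  S = C.
Proof.
move=> cC sSC /set0Pn[e Se] clS; apply/eqP; rewrite eqEsubset sSC /=.
have /imsetP[x Dx defC] := cC; rewrite {C}defC in cC sSC *.
have clo : closed (meets D) S.
  move=> a b /and3P[Da Db ab]; apply/idP/idP => [Sa|Sb]; first exact: clS ab.
  by apply: clS Sb Da _; rewrite disjoint_sym.
have xe : connect (meets D) x e.
  by have := subsetP sSC _ Se; rewrite inE => /andP[].
apply/subsetP => f; rewrite inE => /andP[_ xf].
by rewrite -(closed_connect clo xf) (closed_connect clo xe).
Qed.

(* A connected graph has at most one vertex more than it has edges. *)
Lemma card_cover_component D C : {in D, forall e, #|e| = 2} ->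
  C \in components D -> #|cover C| <= #|C|.+1.
Proof.
move=> D2 cC; have sCD := comp_sub components_partition cC.
have [x xC] : exists x, x \in C.
  by apply/set0Pn; apply: contraTneq cC => ->;
    case/and3P: (components_partition D).
(* A maximal subset of C satisfying the bound is closed under meeting, because an edge that meets
   its cover adds at most one new vertex. Hence it is all of C. *)
pose P S := [&& S \subset C, S != set0 & #|cover S| <= #|S|.+1].
have P1 : P [set x].
  rewrite /P sub1set xC -card_gt0 cards1 /= /cover big_set1 D2 //.
  exact: (subsetP sCD).
have [S /maxsetP[/and3P[sSC S0 leS] maxS] _] := @maxset_exists _ P _ P1.
suff <- : S = C by [].
apply: (components_minimal cC sSC S0) => e f Se Df ef.
have fC : f \in C by apply: (components_closed cC (subsetP sSC _ Se) Df ef).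
have [//|fNS] := boolP (f \in S).
suff defS : f |: S = S by rewrite -defS setU11 in fNS.
apply: maxS; last exact: subsetUr.
rewrite /P subUset sub1set fC sSC /= -card_gt0 cardsU1 fNS /=.
have -> : cover (f |: S) = f :|: cover S by rewrite /cover bigcup_setU big_set1.
rewrite cardsU (D2 f) // -addnBA; last by rewrite subset_leq_card // subsetIr.
suff : 0 < #|f :&: cover S|.
  move=> f_gt0; rewrite !ltnS leq_subLR (leq_trans leS) //.
  by rewrite -add1n leq_add2r.
case/pred0Pn: ef => v /andP[/= ev fv]; apply/card_gt0P; exists v.
by rewrite inE fv; apply/bigcupP; exists e.
Qed.

(** The M-edges in C are disjoint, and each takes up two vertices of the cover of C. *)
Lemma card_setI_matching C M : {in M, forall e, #|e| = 2} -> trivIset M ->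
  #|C :&: M|.*2 <= #|cover C|.
Proof.
move=> M2 tM.
have tI : trivIset (C :&: M) by apply: trivIsetS tM; apply: subsetIr.
have <- : #|cover (C :&: M)| = #|C :&: M|.*2.
  rewrite -(eqnP tI) -muln2 -sum_nat_const; apply: eq_bigr => e.
  by rewrite inE => /andP[_ /M2].
apply/subset_leq_card/bigcupsP => e; rewrite inE => /andP[Ce _].
by apply/subsetP => x ex; apply/bigcupP; exists e.
Qed.

Lemma matching_img_meets s D e f :
  meets (matching_img s D) (edge_img s e) (edge_img s f) = meets D e f.
Proof.
rewrite /meets /= !(mem_imset _ _ (@edge_img_inj _ s)) imset_disjoint //.
exact: perm_inj.
Qed.

Lemma matching_img_connect s D e f :
  connect (meets (matching_img s D)) (edge_img s e) (edge_img s f) =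
  connect (meets D) e f.
Proof.
apply/connectP/connectP => -[p].
  (* After its start, the path visits only images of members of D, so it can be lifted one step at a
     time. *)
  elim: p e => [|g p IHp] e /=; first by move=> _ /edge_img_inj->; exists [::].
  case/andP=> /and3P[De /imsetP[g' Dg ->] eg] pp lp.
  have [q qp lq] := IHp _ pp lp; exists (g' :: q) => //=.
  by rewrite -(matching_img_meets s) /meets /= qp De eg mem_imset ?Dg //; apply: edge_img_inj.
move=> pp ->; exists [seq edge_img s g | g <- p]; last by rewrite last_map.
by rewrite path_map (eq_path (matching_img_meets s D)).
Qed.

Lemma components_img s D :
  components (matching_img s D) = matching_img s @: components D.
Proof.
rewrite /components /equivalence_partition -[matching_img s D]/(_ @: _).
rewrite -!imset_comp; apply: eq_imset => e /=; apply/setP => f.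
rewrite inE; apply/andP/imsetP => [[/imsetP[g Dg ->]]|[g]].
  by rewrite matching_img_connect => eg; exists g; rewrite // inE Dg.
rewrite inE => /andP[Dg eg] ->; split; last by rewrite matching_img_connect.
exact: imset_f.
Qed.

End Components.

(** * Exchanges between two matchings: sizes and symmetries *)

Section MatchingFlips.

Set Implicit Arguments.
Unset Strict Implicit.

Variable G : sgraph.

Implicit Types (C D M N : {set {set G}}) (p q : {set {set G}} * {set {set G}}).

Lemma symdiff_sym M N : symdiff M N = symdiff N M.
Proof. by apply/setP => e; rewrite !inE addbC. Qed.

Lemma card_edge (e : {set G}) : e \in edges G -> #|e| = 2.
Proof.
case/imsetP=> -[x y]; rewrite inE /= => xy ->; rewrite cards2.
by case: eqP xy => // ->; rewrite adj_irr.
Qed.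

Lemma card_component C M N : C \subset symdiff M N ->
  #|C| = #|C :&: M| + #|C :&: N|.
Proof.
move/subsetP=> sCD; rewrite -(cardsID M C); congr (_ + #|pred_of_set _|).
apply/setP => e; rewrite !inE; case Ce: (e \in C); rewrite ?andbF //= andbT.
by move: (sCD e Ce); rewrite inE; case: (e \in M) (e \in N) => [] [].
Qed.

(** Counting vertices, 2 |C :&: N| <= |cover C| <= |C| + 1 = |C :&: M| + |C :&: N| + 1; then |C :&:
    N| cancels. *)
Lemma component_balance i j M N C : is_matching i M -> is_matching j N ->
    C \in components (symdiff M N) ->
  #|C :&: N| <= #|C :&: M|.+1.
Proof.
move=> /and3P[/subsetP sM _ _] /and3P[/subsetP sN tN _] cC.
have D2 : {in symdiff M N, forall e : {set G}, #|e| = 2}.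
  move=> e; rewrite inE => MNe; apply: card_edge.
  by move: MNe; case: (boolP (e \in M)) => [/sM //|_ /sN].
have N2 : {in N, forall e : {set G}, #|e| = 2} by move=> e /sN/card_edge.
have := leq_trans (card_setI_matching C N2 tN) (card_cover_component D2 cC).
by rewrite (card_component (comp_sub (@components_partition G) cC)) -addnn -addSn leq_add2r.
Qed.

(** Edges outside the symmetric difference are common to both matchings, and by [component_balance]
    each component contributes -1, 0 or 1 to j - i. *)
Lemma card_gain_loss i j p : is_matching i p.1 -> is_matching j p.2 ->
  j + #|loss (@components G) p| = i + #|gain (@components G) p|.
Proof.
move=> mM mN; have [_ _ /eqP cM] := and3P mM; have [_ _ /eqP cN] := and3P mN.
set D := symdiff p.1 p.2.
have [/eqP covD tD _] := and3P (components_partition D).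
have cardI A B : #|A :&: B| = \sum_(e in A) (e \in B) :> nat.
  by rewrite -sum1_card big_mkcond [RHS]big_mkcond; apply: eq_bigr => e _;
    rewrite inE; case: (e \in A); case: (e \in B).
have sumI B : \sum_(C in components D) #|C :&: B| = #|D :&: B|.
  rewrite cardI -[in RHS]covD big_trivIset //=.
  by apply: eq_bigr => C _; rewrite cardI.
have defI : p.1 :\: D = p.2 :\: D.
  apply/setP => e; rewrite !inE.
  by case: (e \in p.1) (e \in p.2) => [] [].
rewrite -{}cM -{}cN -(cardsID D p.1) -(cardsID D p.2) defI.
rewrite ![_ + #|_ :\: D|]addnC -!addnA; congr (_ + _).
rewrite ![p.1 :&: _]setIC ![p.2 :&: _]setIC -!sumI -!sum1dep_card.
rewrite !big_mkcondr -!big_split; apply: eq_bigr => C cC /=.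
have := component_balance mM mN cC.
rewrite /D symdiff_sym in cC; have := component_balance mN mM cC.
move: #|_ :&: p.1| #|_ :&: p.2| => a b.
(* The balance in both directions leaves a = b + 1 (a loss), a = b, and b = a + 1 (a gain). *)
rewrite leq_eqVlt => /orP[/eqP->|].
  by rewrite eqxx ltn_eqF ?addn0 ?addn1.
rewrite ltnS leq_eqVlt => /orP[/eqP->|lt_ab].
  by rewrite !ltn_eqF.
rewrite leq_eqVlt => /orP[/eqP->|]; last by rewrite ltnS leqNgt lt_ab.
by rewrite eqxx ltn_eqF ?addn0 ?addn1.
Qed.

(** The edges brought in come from N, and C being a whole component keeps them away from the
    remaining edges of M. The natural subtraction is exact, since [C :&: M] has at most i edges. *)
Lemma symdiff_component_matching i j M N C :
    is_matching i M -> is_matching j N -> C \in components (symdiff M N) ->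
  is_matching (i + #|C :&: N| - #|C :&: M|) (symdiff M C).
Proof.
move=> /and3P[/subsetP sM tM /eqP cM] /and3P[/subsetP sN tN _] cC.
have sCD := comp_sub (@components_partition G) cC.
have C_N e : e \in C -> e \notin M -> e \in N.
  by move/(subsetP sCD); rewrite inE; case: (e \in M).
apply/and3P; split.
- apply/subsetP => e; rewrite inE.
  case: (boolP (e \in M)) => [/sM //|Me Ce]; apply: sN; exact: C_N.
(* Here [a] is kept from M and [b] comes from N. If [a] is also in N, disjointness holds in N;
   otherwise [a] is in the symmetric difference, and touching [b] would put it in C. *)
- have cross a b : a \in M -> a \notin C -> b \in C -> b \notin M ->
      [disjoint a & b].
    move=> Ma Ca Cb Mb; have [Na|Na] := boolP (a \in N).
      apply: (trivIsetP tN) => //; first exact: C_N.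
      by apply: contraNneq Ca => ->.
    apply: contraNT Ca => ab; apply: (components_closed cC Cb).
      by rewrite inE Ma (negPf Na).
    by rewrite disjoint_sym.
  apply/trivIsetP => a b; rewrite !inE.
  case: (boolP (a \in M)) => Ma Ca; case: (boolP (b \in M)) => Mb Cb ab.
  + exact: (trivIsetP tM).
  + exact: cross.
  + by rewrite disjoint_sym; apply: cross.
  + by apply: (trivIsetP tN) => //; apply: C_N.
- rewrite -cM -(cardsID M (symdiff M C)) -(cardsID C M).
  have -> : symdiff M C :&: M = M :\: C.
    apply/setP => e; rewrite !inE.
    by case: (e \in M) (e \in C) => [] [].
  have -> : symdiff M C :\: M = C :&: N.
    apply/setP => e; rewrite !inE; case Ce: (e \in C) => /=.
      by move: (subsetP sCD _ Ce); rewrite inE; case: (e \in M) (e \in N) => [] [].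
    by rewrite addbF andNb.
  by rewrite [C :&: M]setIC -addnA addKn.
Qed.

Lemma flip_matching i j p C : is_matching i p.1 -> is_matching j p.2 ->
    C \in gain (@components G) p ->
  is_matching i.+1 (flip C p).1 /\ is_matching j.-1 (flip C p).2.
Proof.
move=> mM mN; rewrite inE => /andP[cC /eqP gC]; split.
  have := symdiff_component_matching mM mN cC.
  by rewrite gC addnS -addSn addnK.
rewrite symdiff_sym in cC.
have := symdiff_component_matching mN mM cC.
by rewrite gC subnS addnK.
Qed.

Lemma flip_count_matching i j p q : is_matching i p.1 -> is_matching j p.2 ->
    flip_count (@components G) p q != 0 ->
  is_matching i.+1 q.1 /\ is_matching j.-1 q.2.
Proof.
move=> mM mN; rewrite sum_nat_eq0 => /forall_inPn[C gC].
by rewrite eqb0 negbK => /eqP->; apply: flip_matching.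
Qed.

Definition pair_img (s : {perm G}) p := (matching_img s p.1, matching_img s p.2).

Lemma pair_img_inj s : injective (pair_img s).
Proof.
have mI := imset_inj (@edge_img_inj _ s).
by move=> [M N] [M' N'] [/mI-> /mI->].
Qed.

Lemma matching_img_symdiff s M N :
  matching_img s (symdiff M N) = symdiff (matching_img s M) (matching_img s N).
Proof.
have eI := @edge_img_inj _ s; apply/setP => e.
apply/imsetP/idP => [[f MNf ->]|].
  by move: MNf; rewrite !inE !(mem_imset _ _ eI).
rewrite inE => MNe.
have [f ef] : exists f, e = edge_img s f.
  by move: MNe; case: (boolP (e \in _)) => [/imsetP[f _ ->]|_ /imsetP[f _ ->]];
    exists f.
by exists f => //; move: MNe; rewrite ef inE !(mem_imset _ _ eI).
Qed.

Lemma pair_img_gain s p :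
  gain (@components G) (pair_img s p) =
  matching_img s @: gain (@components G) p.
Proof.
have eI := @edge_img_inj _ s.
have cI C M : #|matching_img s C :&: matching_img s M| = #|C :&: M|.
  rewrite /matching_img -imsetI ?card_imset //.
  by move=> ? ? _ _; apply: eI.
apply/setP => C; rewrite inE /= -matching_img_symdiff components_img.
apply/andP/imsetP => [[/imsetP[C' cC' ->]]|[C']].
  by rewrite !cI => gC; exists C'; rewrite // inE cC'.
by rewrite inE => /andP[cC' gC] ->; rewrite !cI; split; first exact: imset_f.
Qed.

Lemma pair_img_flip s C p :
  pair_img s (flip C p) = flip (matching_img s C) (pair_img s p).
Proof. by rewrite /pair_img /flip /= !matching_img_symdiff. Qed.

(** Relabelling the vertices permutes the components along with their gains; this is the source of
    the equivariance of U. *)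
Lemma flip_count_img s p q :
  flip_count (@components G) (pair_img s p) (pair_img s q) =
  flip_count (@components G) p q.
Proof.
rewrite /flip_count pair_img_gain big_imset /=.
  by apply: eq_bigr => C _; rewrite -pair_img_flip (inj_eq (@pair_img_inj s)).
by move=> C C' _ _ /(imset_inj (@edge_img_inj _ s)).
Qed.

End MatchingFlips.

(** * Transfer of a trivial kernel from the integers to characteristic 0 *)

Section IntegerKernel.

Set Implicit Arguments.
Unset Strict Implicit.

Local Open Scope ring_scope.

Variables (A B : finType) (c : A -> B -> nat).

Lemma sum_sqr_eq0 (I : finType) (x : I -> int) :
  \sum_i x i ^+ 2 = 0 -> forall i, x i = 0.
Proof.
move=> x0 i; apply/eqP; rewrite -sqrf_eq0.
by rewrite (psumr_eq0P _ x0) // => j _; apply: sqr_ge0.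
Qed.

(* The Gram matrix of c is nonsingular over the integers, hence its
   determinant stays nonzero in characteristic 0. *)
Lemma kernel_pchar0 (F : fieldType) : [pchar F] =i pred0 ->
    (forall v : A -> int, (forall b, \sum_a v a * (c a b)%:R = 0) ->
      forall a, v a = 0) ->
  forall v : A -> F, (forall b, \sum_a v a * (c a b)%:R = 0) ->
    forall a, v a = 0.
Proof.
move=> charF kerZ v kv a.
(* One matrix for all coefficient rings, so that its versions over the integers and over F can be
   compared. *)
pose M (R : comNzRingType) : 'M[R]_(#|A|, #|B|) :=
  \matrix_(i, j) (c (enum_val i) (enum_val j))%:R.
have MP (R : comNzRingType) (w : 'rV[R]_#|A|) j :
    (w *m M R) 0 j = \sum_a w 0 (enum_rank a) * (c a (enum_val j))%:R.
  rewrite !mxE (reindex enum_rank) /=; last first.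
    by apply: onW_bij; apply: enum_rank_bij.
  by apply: eq_bigr => b _; rewrite !mxE enum_rankK.
have detZ : \det (M int *m (M int)^T) != 0.
  (* If w M M^T = 0, then w M M^T w^T = 0 is the sum of the squares of the entries of w M, so w M =
     0. *)
  apply/det0P => -[w w0 wMM]; case/negP: w0; apply/eqP/rowP => i.
  have wM : w *m M int = 0.
    apply/rowP => j; rewrite [RHS]mxE.
    apply: (sum_sqr_eq0 (x := fun j => (w *m M int) 0 j)).
    have := congr1 (fun X => (X *m w^T) 0 0) wMM.
    rewrite mul0mx [RHS]mxE mulmxA -mulmxA -trmx_mul mxE => wMMw; rewrite -[RHS]wMMw.
    by apply: eq_bigr => k _; rewrite [_^T _ _]mxE expr2.
  rewrite -[i]enum_valK [RHS]mxE.
  apply: (kerZ (fun a => w 0 (enum_rank a))) => b.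
  by rewrite -(enum_rankK b) -MP wM mxE.
have detF : \det (M F *m (M F)^T) != 0.
  have MF : M F = map_mx intr (M int).
    by apply/matrixP => i j; rewrite !mxE rmorph_nat.
  (* The determinant over F is the image of the integer one, and the integers embed in F. *)
  rewrite MF map_trmx -map_mxM det_map_mx.
  have inF0 n : (n%:R == 0 :> F) = (n == 0)%N.
    by move: n; apply/pcharf0P.
  case: (\det _) detZ => n //=.
    by rewrite -[n%:~R]/(n%:R) inF0.
  by rewrite NegzE rmorphN oppr_eq0 /= -[n.+1%:~R]/(n.+1%:R) inF0.
pose w : 'rV[F]_#|A| := \row_i v (enum_val i).
have wM : w *m M F = 0.
  apply/rowP => j; rewrite MP [RHS]mxE -[RHS](kv (enum_val j)).
  by apply: eq_bigr => b _; rewrite mxE enum_rankK.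
suff /rowP/(_ (enum_rank a)) : w = 0 by rewrite !mxE enum_rankK.
apply/eqP; apply: contraNT detF => w0; apply/det0P; exists w => //.
by rewrite mulmxA wM mul0mx.
Qed.

End IntegerKernel.

(** * The exchange operator on the tensor products *)

Section FlipOperator.

Set Implicit Arguments.
Unset Strict Implicit.

Variable G : sgraph.

Local Notation count := (flip_count (@components G)).

Definition matching_pair i j (a : kmatching G i * kmatching G j) :=
  (val a.1, val a.2).

Lemma matching_pair_inj i j : injective (@matching_pair i j).
Proof. by move=> [M N] [M' N'] [/val_inj-> /val_inj->]. Qed.

Local Open Scope ring_scope.

(** This is |v X|^2 = v (X X^T) v^T; it brings in the Gram matrix that the commutator relation
    rewrites. *)
Lemma sum_sqr_expand (I J : finType) (v : I -> int) (x : I -> J -> nat) :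
  \sum_j (\sum_i v i * (x i j)%:R) ^+ 2 =
  \sum_i \sum_i' v i * v i' * (\sum_j x i j * x i' j)%N%:R.
Proof.
transitivity (\sum_j \sum_i \sum_i' v i * v i' * (x i j * x i' j)%:R).
  apply: eq_bigr => j _; rewrite expr2 mulr_suml; apply: eq_bigr => i _.
  by rewrite mulr_sumr; apply: eq_bigr => i' _; rewrite natrM mulrACA.
rewrite exchange_big; apply: eq_bigr => i _; rewrite exchange_big.
by apply: eq_bigr => i' _; rewrite natr_sum mulr_sumr.
Qed.

(** For v in the kernel, the commutator relation gives 0 = |v U|^2 = |v U^T|^2 + (j - i) |v|^2,
    where both summands are nonnegative and j - i > 0. *)
Lemma flip_count_kernel i j : (i.+1 < j)%N ->
  forall v : kmatching G i * kmatching G j -> int,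
    (forall b : kmatching G i.+1 * kmatching G j.-1,
       \sum_a v a * (count (matching_pair a) (matching_pair b))%:R = 0) ->
  forall a, v a = 0.
Proof.
move=> lt_ij v kv.
(* The commutator relation sums over all pairs [q], so the kernel condition is extended to them; the
   additional entries vanish. *)
have kerq q : \sum_a v a * (count (matching_pair a) q)%:R = 0.
  have [/andP[m1 m2]|Nm] := boolP (is_matching i.+1 q.1 && is_matching j.-1 q.2).
    rewrite -[RHS](kv (Sub q.1 m1, Sub q.2 m2)); apply: eq_bigr => a _.
    by rewrite [in RHS]/matching_pair /= -surjective_pairing.
  apply: big1 => a _; have [->|] := eqVneq (count (matching_pair a) q) 0%N.
    by rewrite mulr0.
  case/(flip_count_matching (p := matching_pair a) (valP a.1) (valP a.2)) => m1 m2.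
  by rewrite m1 m2 in Nm.
have sq0 : \sum_q (\sum_a v a * (count (matching_pair a) q)%:R) ^+ 2 = 0.
  by apply: big1 => q _; rewrite kerq expr0n.
pose h : int := j%:R - i%:R.
have h_gt0 : 0 < h by rewrite subr_gt0 ltr_nat ltnW.
move: sq0; rewrite sum_sqr_expand.
have -> : \sum_a \sum_a' v a * v a' *
      (\sum_q count (matching_pair a) q * count (matching_pair a') q)%N%:R =
    \sum_q (\sum_a v a * (count q (matching_pair a))%:R) ^+ 2 +
    h * \sum_a v a ^+ 2.
  rewrite (sum_sqr_expand v (fun a q => count q (matching_pair a))).
  rewrite mulr_sumr -big_split; apply: eq_bigr => a _ /=.
  have -> : h * v a ^+ 2 = \sum_a' v a * v a' * (h * (a' == a)%:R).
    rewrite (bigD1 a) //= big1 ?addr0 => [|a' /negPf->]; last by rewrite !mulr0.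
    by rewrite eqxx mulr1 mulrC expr2.
  rewrite -big_split; apply: eq_bigr => a' _ /=; rewrite -mulrDr; congr (_ * _).
  have := flip_count_commutator (@components_partition G)
    (matching_pair a) (matching_pair a').
  rewrite (inj_eq (@matching_pair_inj i j)) => /(congr1 (fun n : nat => n%:R : int)).
  rewrite !natrD !natrM => /(canRL (addrK _))->; rewrite -addrA -mulrBl.
  (* The diagonal coefficient, gains minus losses, is the same for every [a]: it is j - i by
     [card_gain_loss]. *)
  congr (_ + _ * _); apply/eqP; rewrite subr_eq -subr_eq0 /h.
  have := card_gain_loss (p := matching_pair a) (valP a.1) (valP a.2).
  move=> /(congr1 (fun n : nat => n%:R : int)); rewrite !natrD => e.
  by rewrite addrAC e addrC addKr subrr.
move=> sum0; apply: sum_sqr_eq0; apply/eqP.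
have := sum0; move/eqP; rewrite paddr_eq0.
- by case/andP=> _; rewrite mulf_eq0 (gt_eqF h_gt0).
- by apply: sumr_ge0 => q _; apply: sqr_ge0.
- apply: mulr_ge0; first exact: ltW.
  by apply: sumr_ge0 => a _; apply: sqr_ge0.
Qed.

Variable F : fieldType.

Lemma flift_flift (I J : finType) (W : lmodType F) (f : J -> W)
    (g : I -> freeV F J) (t : freeV F I) :
  flift f (flift g t) = flift (flift f \o g) t.
Proof.
by rewrite {2}/flift linear_sum; apply: eq_bigr => i _; rewrite linearZ.
Qed.

(** The row of U at [a]. The target sizes are free indices, so that the operator lands in the spaces
    of the theorem without casts. *)
Definition flip_op i j i' j' (a : kmatching G i * kmatching G j) :
    tensorV F (kmatching G i') (kmatching G j') :=
  [ffun b => (count (matching_pair a) (matching_pair b))%:R].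

Lemma kmatching_actK k (s : [subg autG G]) :
  cancel (@kmatching_act G k s^-1%g) (kmatching_act s).
Proof. by move=> M; rewrite -kmatching_actM mulVg kmatching_act1. Qed.

Lemma kmatching_actKV k (s : [subg autG G]) :
  cancel (@kmatching_act G k s) (kmatching_act s^-1%g).
Proof. by move=> M; rewrite -kmatching_actM mulgV kmatching_act1. Qed.

Lemma flip_op_equivariant i j i' j' (s : [subg autG G])
    (t : tensorV F (kmatching G i) (kmatching G j)) :
  flift (@flip_op i j i' j') (VVact s t) =
  VVact s (flift (@flip_op i j i' j') t).
Proof.
rewrite /VVact !flift_flift; apply: eq_bigr => a _; congr (_ *: _).
rewrite /= tens_basis flift_basis.
(* The preimage [b'] of [b] under [s] indexes the only term of the sum that survives at coordinate
   [b]. *)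
apply/ffunP => b; pose b' := (kmatching_act s^-1%g b.1, kmatching_act s^-1%g b.2).
rewrite sum_ffunE (bigD1 b') //= big1 => [|c].
  rewrite tens_basis !ffunE /= !kmatching_actK -surjective_pairing eqxx.
  rewrite addr0 [RHS]mulr1 -[in RHS](flip_count_img (sgval s)).
  congr (_%:R); congr (flip_count _ _ _).
  by rewrite /pair_img /matching_pair /= -[in LHS](kmatching_actK s b.1)
     -[in LHS](kmatching_actK s b.2).
move=> cb; rewrite tens_basis !ffunE [_ == _](_ : _ = false) ?scaler0 //.
apply: contraNF cb => /eqP eb; rewrite /b' eb /= !kmatching_actKV.
by rewrite -surjective_pairing.
Qed.

End FlipOperator.

Theorem theorem1p3 (G : sgraph) (F : fieldType)
    (charF0 : [pchar F]%R =i pred0) (l k : nat) (l_ge1 : 1 <= l) (le_lk : l <= k) :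
  exists f : {linear tensorV F (kmatching G (l - 1)) (kmatching G (k + 1)) ->
                     tensorV F (kmatching G l) (kmatching G k)},
    injective f /\
    (forall (s : [subg autG G])
            (t : tensorV F (kmatching G (l - 1)) (kmatching G (k + 1))),
       f (VVact s t) = VVact s (f t)).
Proof.
case: l l_ge1 le_lk => // l _ lt_lk; rewrite subn1 addn1 /=.
(* With l shifted by one, U goes from sizes (l, k + 1) to (l + 1, k). *)
exists (flift (@flip_op G F l k.+1 l.+1 k)); split; last exact: flip_op_equivariant.
apply: raddf_inj => t ft0; apply/ffunP => a; rewrite [RHS]ffunE.
(* This is the shifted hypothesis l + 1 <= k up to computation, in the form that [flip_count_kernel]
   expects. *)
have lt_lSk : l.+1 < k.+1 by [].
apply: (kernel_pchar0 charF0 (flip_count_kernel (G := G) lt_lSk)) => b.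
have /ffunP/(_ b) := ft0; rewrite /flift sum_ffunE [RHS]ffunE => ftb.
by rewrite -[RHS]ftb; apply: eq_bigr => c _; rewrite !ffunE.
Qed.
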